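(* During $T$ rounds, the algorithm RS-SlateGLinCB (described in the context) updates its policy (i.e. recomputes its parameter estimate) at most $O(Nd\log T)$ times.
   Context: **Setting.** There are $N$ slots, items have dimension $d$, the horizon is $T$. At round $t\in\{1,\dots,T\}$ the learner receives item sets $\mathcal{X}_t^1,\dots,\mathcal{X}_t^N\subset\mathbb{R}^d$ (possibly adversarially chosen), picks $\bm{x}_t^i\in\mathcal{X}_t^i$ for each $i$, plays the slate $\bm{x}_t=(\bm{x}_t^1,\dots,\bm{x}_t^N)\in\mathbb{R}^{Nd}$, and observes one scalar reward $r_t$. For $\bm{v}\in\mathbb{R}^{Nd}$, $\bm{v}^i\in\mathbb{R}^d$ is its $i$-th block; $\|\bm{x}\|_{\bm{A}}=\sqrt{\bm{x}^\top\bm{A}\bm{x}}$. **Rewards (GLM).** Given $\bm{x}_t=\bm{x}$, the reward has density $\exp(r\,\bm{x}^\top\bm\theta^\star-b(\bm{x}^\top\bm\theta^\star)+c(r))$ with $r\in[0,R]$ almost surely, $\|\bm\theta^\star\|_2\le S$, $b$ twice differentiable; $\mu=\dot b$ is monotonic, $L_\mu$-Lipschitz, and $|\ddot\mu|\le R\dot\mu$. All items satisfy $\|\bm{z}\|_2\le1/\sqrt N$. $\kappa=\sup_{\bm{x}}\sup_{\|\bm\theta\|\le S}1/\dot\mu(\bm{x}^\top\bm\theta)$, the first supremum over all slates of all rounds. The constants $S,T,R,N,d,\kappa,L_\mu$ are greater than $1$; $\delta\in(0,1)$. **MLE.** For a set of rounds $\mathcal{T}$, the maximum likelihood estimate is the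 maximizer over $\bm\theta$ of $\sum_{s\in\mathcal{T}}\big(r_s\bm{x}_s^\top\bm\theta-b(\bm{x}_s^\top\bm\theta)\big)$; it is assumed to satisfy $\|\widehat{\bm\theta}\|_2\le S$. **Algorithm RS-SlateGLinCB.** Parameters $\lambda=O(NdR^2S^{-1}\log(T/\delta))$, $\gamma=O(R^2S^{3/2}\sqrt{Nd\log(ST/\delta)})$, $\beta=O(R\sqrt{NdS\log(ST/\delta)})$. *Warm-up* $\mathcal{T}_0$ (the first $\lfloor\sqrt T\rfloor$ rounds): starting with $\bm{V}^i=\lambda\bm{I}_d$, at each round choose $\bm{x}_t^i\in\arg\max_{\bm{z}\in\mathcal{X}_t^i}\|\bm{z}\|_{(\bm{V}^i)^{-1}}$ with the current $\bm{V}^i$, play $\bm{x}_t$, and update $\bm{V}^i\leftarrow\bm{V}^i+\bm{x}_t^i{\bm{x}_t^i}^\top$. $\widehat{\bm\theta}_0$ is the MLE on $\mathcal{T}_0$. *Main phase:* for $t>|\mathcal{T}_0|$ let $\bm{H}_t=\lambda\bm{I}_{Nd}+\sum_{k=|\mathcal{T}_0|+1}^{t-1}\frac{\dot\mu(\bm{x}_k^\top\widehat{\bm\theta}_0)}{e}\bm{x}_k\bm{x}_k^\top$ and $\bm{H}_t^i=\lambda\bm{I}_d+\sum_{k=|\mathcal{T}_0|+1}^{t-1}\frac{\dot\mu(\bm{x}_k^\top\widehat{\bm\theta}_0)}{e}\bm{x}_k^i{\bm{x}_k^i}^\top$. Let $s$ be the last round at which an estimate was computed (initially $s=|\mathcal{T}_0|$,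 $\bm{H}_s=\lambda\bm{I}_{Nd}$, and the current estimate is $\widehat{\bm\theta}_0$). At round $t$: if $\det\bm{H}_t\ge2\det\bm{H}_s$ (a policy update), set $s\leftarrow t$ and let $\widehat{\bm\theta}_s$ be the MLE on rounds $\{|\mathcal{T}_0|+1,\dots,t-1\}$. Then, for each slot $i$, replace $\mathcal{X}_t^i$ by $\{\bm{z}\in\mathcal{X}_t^i:\mathrm{UCB}^{i,0}(\bm{z})\ge\max_{\bm{y}\in\mathcal{X}_t^i}\mathrm{LCB}^{i,0}(\bm{y})\}$, where UCB/LCB are $\bm{z}^\top\widehat{\bm\theta}_0^i\pm2\sqrt\kappa\gamma\|\bm{z}\|_{(\bm{V}^i)^{-1}}$, and choose $\bm{x}_t^i\in\arg\max_{\bm{z}\in\mathcal{X}_t^i}\{\bm{z}^\top\widehat{\bm\theta}_s^i+2\sqrt2\,\beta\|\bm{z}\|_{(\bm{H}_t^i)^{-1}}\}$ from the remaining items. Play $\bm{x}_t$. *)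

(* Defs.v *)
From HB Require Import structures.
From mathcomp Require Import all_boot all_order all_algebra.
From mathcomp Require Import all_classical all_reals all_analysis.

Set Implicit Arguments.
Unset Strict Implicit.
Unset Printing Implicit Defensive.

Import Order.TTheory GRing.Theory Num.Theory.
Import numFieldNormedType.Exports.

Local Open Scope classical_set_scope.
Local Open Scope ring_scope.

(* Vectors are row vectors, so the x^T A y, x x^T and x^T y of column-vector
   notation become x *m A *m y^T, x^T *m x and x *m y^T. Euclidean norms are
   written out because `|x| is the sup norm on matrices. *)
Section Vectors.
Context {R : realType}.

Definition dot n (u v : 'rV[R]_n) : R := (u *m v^T) 0 0.

Definition l2norm n (u : 'rV[R]_n) : R := Num.sqrt (dot u u).

Definition wnorm n (A : 'M[R]_n) (u : 'rV[R]_n) : R :=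
  Num.sqrt ((u *m A *m u^T) 0 0).

Definition outer n (u : 'rV[R]_n) : 'M[R]_n := u^T *m u.

(* R^(Nd) is 'rV_(N * d), viewed through vec_mx as N rows of length d. *)
Definition block N d (v : 'rV[R]_(N * d)) (i : 'I_N) : 'rV[R]_d :=
  row i (vec_mx v).

Definition slates N d (X : 'I_N -> set 'rV[R]_d) : set 'rV[R]_(N * d) :=
  [set x | forall i, X i (block x i)].

Definition is_argmax (U : Type) (A : set U) (f : U -> R) (x : U) : Prop :=
  A x /\ forall y, A y -> f y <= f x.

End Vectors.

Section Model.
Context {R : realType}.

(* derive1 b is mu; derive1n 2 b and derive1n 3 b are its first two
   derivatives. *)
Record glm_link (Rmax Lmu : R) (b : R -> R) : Prop := GlmLink {
  link_derivable1 : forall z, derivable b z 1;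
  link_derivable2 : forall z, derivable (derive1 b) z 1;
  link_monotone : {homo derive1 b : x y / x <= y};
  link_lipschitz : Lmu.-lipschitz (derive1 b);
  link_selfconc : forall z, derivable (derive1n 2 b) z 1 /\
    `|derive1n 3 b z| <= Rmax * derive1n 2 b z }.

(* Given x = v, the reward r has density
   rho |-> exp(rho * v.theta - b(v.theta) + c(rho)) with respect to nu: the
   disintegration identity is required on the rectangles x^-1(\prod_j E j),
   a pi-system generating the sigma-algebra of x. *)
Definition reward_density n disp (Om : measurableType disp)
    (P : probability Om R) (nu : {sigma_finite_measure set R -> \bar R})
    (b c : R -> R) (theta : 'rV[R]_n) (x : Om -> 'rV[R]_n) (r : Om -> R) :=
  forall (E : 'I_n -> set R) (B : set R),
    (forall j, measurable (E j)) -> measurable B ->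
    let A := [set w | forall j, E j (x w 0 j)] in
    P (A `&` r @^-1` B) =
    (\int[P]_(w in A) \int[nu]_(rho in B)
       (expR (rho * dot (x w) theta - b (dot (x w) theta) + c rho))%:E)%E.

(* Item sets may depend on the outcome w, which allows an adaptive adversary.
   kappa is compared with a supremum in \bar R, where 0^-1 = +oo. *)
Record slate_glm (N d T : nat) (S Rmax Lmu kappa : R) disp
    (Om : measurableType disp) (P : probability Om R)
    (nu : {sigma_finite_measure set R -> \bar R}) (b c : R -> R)
    (theta : 'rV[R]_(N * d)) (X : Om -> nat -> 'I_N -> set 'rV[R]_d)
    (x : Om -> nat -> 'rV[R]_(N * d)) (r : Om -> nat -> R) : Prop := SlateGlm {
  model_link : glm_link Rmax Lmu b;
  model_c : measurable_fun setT c;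
  model_theta : l2norm theta <= S;
  model_items : forall w t i z, (1 <= t <= T)%N -> X w t i z ->
    l2norm z <= (Num.sqrt N%:R)^-1;
  model_kappa : kappa%:E = ereal_sup [set e : \bar R |
    exists w t (y th : 'rV[R]_(N * d)),
      [/\ (1 <= t <= T)%N, slates (X w t) y, l2norm th <= S &
          e = ((derive1n 2 b (dot y th))%:E^-1)%E]];
  model_x_meas : forall t j, (1 <= t <= T)%N ->
    measurable_fun setT (fun w => x w t 0 j);
  model_r_meas : forall t, (1 <= t <= T)%N ->
    measurable_fun setT (fun w => r w t);
  model_r_range : forall t, (1 <= t <= T)%N ->
    {ae P, forall w, 0 <= r w t <= Rmax};
  model_r_law : forall t, (1 <= t <= T)%N ->
    reward_density P nu b c theta (fun w => x w t) (fun w => r w t) }.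

End Model.

(* One trajectory: item sets X, slates x, rewards r and estimates est, all
   indexed by rounds 1..T; est s is the estimate computed at round s, and
   est (warmup T) is the warm-up estimate. *)
Section Algorithm.
Context {R : realType} (N d T : nat) (S kappa lambda gamma beta : R).
Context (b : R -> R) (X : nat -> 'I_N -> set 'rV[R]_d).
Context (x : nat -> 'rV[R]_(N * d)) (r : nat -> R).
Context (est : nat -> 'rV[R]_(N * d)).

Definition warmup : nat := Num.truncn (Num.sqrt (T%:R : R)).

Definition loglik (m n : nat) (th : 'rV[R]_(N * d)) : R :=
  \sum_(m <= s < n) (r s * dot (x s) th - b (dot (x s) th)).

(* The maximum likelihood estimate on rounds m..n-1, of norm at most S. *)
Definition is_mle (m n : nat) (th : 'rV[R]_(N * d)) : Prop :=
  is_argmax setT (loglik m n) th /\ l2norm th <= S.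

(* The value of V^i at the start of round t of the warm-up; its final value
   is the one at t = warmup.+1. *)
Definition Vmx (t : nat) (i : 'I_N) : 'M[R]_d :=
  lambda%:M + \sum_(1 <= k < t) outer (block (x k) i).

Definition weight (k : nat) : R :=
  derive1n 2 b (dot (x k) (est warmup)) / expR 1.

(* At t = warmup the sum is empty, so that Hmx warmup = lambda%:M. *)
Definition Hmx (t : nat) : 'M[R]_(N * d) :=
  lambda%:M + \sum_(warmup.+1 <= k < t) weight k *: outer (x k).

Definition Hmxi (t : nat) (i : 'I_N) : 'M[R]_d :=
  lambda%:M + \sum_(warmup.+1 <= k < t) weight k *: outer (block (x k) i).

(* [last_update n] is the value of s at the end of round warmup + n. *)
Fixpoint last_update (n : nat) : nat :=
  if n is n'.+1 then
    let t := (warmup + n)%N in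
    if 2 * \det (Hmx (last_update n')) <= \det (Hmx t)
    then t else last_update n'
  else warmup.

Definition is_update (t : nat) : bool :=
  (warmup < t)%N &&
  (2 * \det (Hmx (last_update (t - warmup).-1)) <= \det (Hmx t)).

Definition num_updates : nat := (\sum_(1 <= t < T.+1) is_update t)%N.

Definition conf0 (i : 'I_N) (z : 'rV[R]_d) : R :=
  2 * Num.sqrt kappa * gamma * wnorm (invmx (Vmx warmup.+1 i)) z.

Definition UCB0 (i : 'I_N) (z : 'rV[R]_d) : R :=
  dot z (block (est warmup) i) + conf0 i z.

Definition LCB0 (i : 'I_N) (z : 'rV[R]_d) : R :=
  dot z (block (est warmup) i) - conf0 i z.

Definition remaining (t : nat) (i : 'I_N) : set 'rV[R]_d :=
  [set z | X t i z /\ forall y, X t i y -> LCB0 i y <= UCB0 i z].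

Definition index (t : nat) (i : 'I_N) (z : 'rV[R]_d) : R :=
  dot z (block (est (last_update (t - warmup))) i)
  + 2 * Num.sqrt 2 * beta * wnorm (invmx (Hmxi t i)) z.

Record rs_slate_glincb_run : Prop := RsSlateGLinCBRun {
  run_warmup : forall t i, (1 <= t <= warmup)%N ->
    is_argmax (X t i) (wnorm (invmx (Vmx t i))) (block (x t) i);
  run_est0 : is_mle 1 warmup.+1 (est warmup);
  run_est : forall t, (warmup < t <= T)%N -> is_update t ->
    is_mle warmup.+1 t (est t);
  run_main : forall t i, (warmup < t <= T)%N ->
    is_argmax (remaining t i) (index t i) (block (x t) i) }.

End Algorithm.

Arguments num_updates {R N d} T lambda b x est.

(* Main.v *)
Require Import Defs.
From HB Require Import structures.
From mathcomp Require Import all_boot all_order all_algebra.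
From mathcomp Require Import all_classical all_reals all_analysis.
From mathcomp Require Import ring.
Set Implicit Arguments.
Unset Strict Implicit.
Unset Printing Implicit Defensive.
Import Order.TTheory GRing.Theory Num.Theory.
Import numFieldNormedType.Exports.
Local Open Scope classical_set_scope.
Local Open Scope ring_scope.

(* Each update at least doubles det H, which starts at lambda^(Nd). Conversely,
   Hadamard's inequality bounds det H_t by the product of its diagonal entries,
   each at most lambda + T * Lmu: the weights are at most Lmu / e and the
   coordinates of a slate at most 1 in absolute value. Since lambda is bounded
   below by a positive constant lambda0, 2^k <= (T * (1 + Lmu / lambda0))^(Nd)
   for the number k of updates. *)

(** * Positive definite matrices and Hadamard's inequality *)

Lemma posdef_diag_gt0 (R : realFieldType) n (A : 'M[R]_n) :
    (forall u : 'rV_n, u != 0 -> 0 < (u *m A *m u^T) 0 0) ->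
  forall i, 0 < A i i.
Proof.
move=> A_gt0 i; have := A_gt0 (delta_mx 0 i).
rewrite trmx_delta -rowE -colE !mxE; apply.
apply/eqP => /matrixP/(_ 0 i); rewrite !mxE !eqxx; exact/eqP/oner_neq0.
Qed.

(* Hadamard's inequality: the diagonal of the Schur complement of the top left
   entry is dominated by the rest of the diagonal of A. *)
Lemma det_posdef_le (R : realFieldType) n (A : 'M[R]_n) :
    A^T = A -> (forall u : 'rV_n, u != 0 -> 0 < (u *m A *m u^T) 0 0) ->
  \det A <= \prod_i A i i.
Proof.
elim: n A => [|n IHn] A A_sym A_gt0; first by rewrite det_mx00 big_ord0.
have a_gt0 := posdef_diag_gt0 A_gt0 0.
set a := A 0 0 in a_gt0; have a_neq0 : a != 0 by rewrite gt_eqF.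
pose M : 'M[R]_(1 + n) := A.
pose v := ursubmx M; pose B := drsubmx M.
have defM : M = block_mx a%:M v v^T B.
  rewrite -[LHS]submxK; congr block_mx.
    rewrite [LHS]mx11_scalar !mxE; congr ((A _ _)%:M); exact: val_inj.
  by rewrite trmx_ursub [M^T]A_sym.
have B_sym : B^T = B by rewrite trmx_drsub [M^T]A_sym.
pose C := B - a^-1 *: (v^T *m v).
have C_sym : C^T = C by rewrite linearB linearZ /= trmx_mul trmxK B_sym.
have detA : \det A = a * \det C.
  have : \det (M *m block_mx 1 (- (a^-1 *: v)) 0 1%:M) = a * \det C.
    rewrite defM mulmx_block !mulmx0 !mulmx1 !addr0 !mulmxN.
    rewrite -!scalemxAr mul_scalar_mx scalerA mulVf // scale1r addNr.
    rewrite det_lblock det_scalar1 /C; congr (_ * \det _).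
    by rewrite addrC.
  by rewrite det_mulmx det_ublock !det1 !mulr1.
have C_gt0 (u : 'rV_n) : u != 0 -> 0 < (u *m C *m u^T) 0 0.
  move=> u_neq0.
  (* This [t] makes the first coordinate of [row_mx t u *m M] vanish, so the form of [M] at
     [row_mx t u] is the form of [C] at [u]. *)
  pose t := - (a^-1 *: (u *m v^T)).
  have : row_mx t u != 0 -> 0 < (row_mx t u *m M *m (row_mx t u)^T) 0 0.
    exact: A_gt0.
  rewrite defM mul_row_block tr_row_mx mul_row_col.
  have -> : t *m a%:M + u *m v^T = 0.
    by rewrite mul_mx_scalar scalerN scalerA mulfV // scale1r addNr.
  rewrite mul0mx add0r.
  have -> : t *m v + u *m B = u *m C.
    by rewrite mulNmx -scalemxAl -mulmxA mulmxBr -scalemxAr addrC.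
  apply; apply: contra_neq u_neq0 => /(congr1 rsubmx).
  by rewrite row_mxKr linear0.
rewrite detA big_ord_recl ler_wpM2l ?(ltW a_gt0) //.
apply: le_trans (IHn _ C_sym C_gt0) _; apply: ler_prod => i _.
rewrite (ltW (posdef_diag_gt0 C_gt0 i)) /=.
have -> : C i i = B i i - a^-1 * v 0 i ^+ 2.
  by rewrite !mxE big_ord1 !mxE expr2.
have -> : B i i = A (lift 0 i) (lift 0 i).
  by rewrite !mxE !rshift1.
by rewrite gerBl mulr_ge0 ?sqr_ge0 // invr_ge0 ltW.
Qed.

(** * Derivatives of monotone and Lipschitz functions *)

Lemma derive1_ge0_nondecreasing (R : realType) (f : R -> R) (z : R) :
  {homo f : x y / x <= y} -> derivable f z 1 -> 0 <= derive1 f z.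
Proof.
move=> f_homo df; rewrite derive1E; apply: limr_ge => //.
near=> h; have h0 : h != 0 by near: h; exact: nbhs_dnbhs_neq.
rewrite /= /shift /= /GRing.scale /= mulr1.
(* The increment of [f] has the sign of [h], so the quotient is nonnegative on both sides of 0. *)
case: (ltrgtP h 0) h0 => // h0 _.
  by rewrite mulr_le0 ?invr_le0 ?(ltW h0) // subr_le0 f_homo // gerDr ltW.
by rewrite mulr_ge0 ?invr_ge0 ?(ltW h0) // subr_ge0 f_homo // lerDr ltW.
Unshelve. all: by end_near. Qed.

Lemma derive1_le_lipschitz (R : realType) (k : R) (f : R -> R) (z : R) :
  k.-lipschitz f -> derivable f z 1 -> derive1 f z <= k.
Proof.
move=> f_lip df; rewrite derive1E; apply: limr_le => //.
near=> h; have h0 : h != 0 by near: h; exact: nbhs_dnbhs_neq.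
rewrite /= /shift /= /GRing.scale /= mulr1.
apply: le_trans (ler_norm _) _.
rewrite normrM normfV ler_pdivrMl ?normr_gt0 // mulrC.
by have := f_lip (h + z, z) (conj I I); rewrite /= addrK.
Unshelve. all: by end_near. Qed.

(** * Determinants of the design matrices *)

Section DesignMatrix.
Context {R : realType} (N d T : nat) (lambda : R) (b : R -> R).
Context (x est : nat -> 'rV[R]_(N * d)).

Let H := Hmx T lambda b x est.
Let w := weight T b x est.

Lemma Hmx_sym t : (H t)^T = H t.
Proof.
rewrite /H /Hmx linearD /= tr_scalar_mx linear_sum /=; congr (_ + _).
by apply: eq_bigr => k _; rewrite linearZ /= /outer trmx_mul trmxK.
Qed.

(** Strict positivity comes from [lambda]; each round only adds its weight times the square of the
    inner product of [x k] and [u]. *)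
Lemma Hmx_posdef t : 0 < lambda ->
    (forall k, (@warmup R T < k < t)%N -> 0 <= w k) ->
  forall u : 'rV_(N * d), u != 0 -> 0 < (u *m H t *m u^T) 0 0.
Proof.
move=> lambda_gt0 w_ge0 u u_neq0.
have uu_gt0 : 0 < (u *m u^T) 0 0.
  have [j uj] : exists j, u 0 j != 0.
    apply/existsP; apply: contra_neqT u_neq0 => /existsPn u0.
    by apply/rowP => j; rewrite mxE; apply/eqP/negPn/u0.
  rewrite mxE (bigD1 j) //= mxE ltr_pwDl //.
    by rewrite -expr2 lt_neqAle sqr_ge0 eq_sym sqrf_eq0 uj.
  by apply: sumr_ge0 => i _; rewrite mxE -expr2 sqr_ge0.
rewrite /H /Hmx mulmxDr mulmxDl mul_mx_scalar -scalemxAl mxE ltr_pwDl //.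
  by rewrite mxE mulr_gt0.
rewrite mulmx_sumr mulmx_suml summxE big_nat_cond sumr_ge0 // => k.
rewrite andbT => /w_ge0 wk_ge0.
rewrite -scalemxAr -scalemxAl mxE mulr_ge0 // /outer mulmxA -[_ *m u^T]mulmxA.
(* A 1 x 1 matrix equals its transpose, which turns the product into a square. *)
have -> : x k *m u^T = (u *m (x k)^T)^T by rewrite trmx_mul trmxK.
by rewrite mxE big_ord1 [X in _ * X]mxE -expr2 sqr_ge0.
Qed.

Lemma det_Hmx_le (L : R) t : 0 < lambda -> 0 <= L ->
    (forall k, (@warmup R T < k < t)%N -> 0 <= w k <= L) ->
    (forall k j, (@warmup R T < k < t)%N -> x k 0 j ^+ 2 <= 1) ->
  \det (H t) <= (lambda + t%:R * L) ^+ (N * d).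
Proof.
move=> lambda_gt0 L_ge0 w_bound x_bound.
have H_gt0 := @Hmx_posdef t lambda_gt0 (fun k kt => proj1 (andP (w_bound k kt))).
apply: le_trans (det_posdef_le (Hmx_sym t) H_gt0) _.
rewrite -[X in _ ^+ X]card_ord -prodr_const; apply: ler_prod => j _.
rewrite (ltW (posdef_diag_gt0 H_gt0 j)) /= /H /Hmx !mxE eqxx mulr1n lerD2l.
(* The sum has [t - warmup.+1] terms, bounded crudely by [t]. *)
have le_tL : L *+ (t - (@warmup R T).+1) <= t%:R * L.
  by rewrite mulr_natl ler_wpMn2l // leq_subr.
rewrite summxE; apply: le_trans le_tL; rewrite -sumr_const_nat.
apply: ler_sum_nat => k kt; rewrite !mxE big_ord1 !mxE -expr2.
have /andP[wk_ge0 wkL] := w_bound k kt.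
by rewrite -[L]mulr1 ler_pM ?sqr_ge0 // x_bound.
Qed.

Lemma last_update_le n : (last_update T lambda b x est n <= @warmup R T + n)%N.
Proof.
elim: n => [|n IHn] /=; first by rewrite addn0.
by case: ifP => // _; rewrite addnS leqW.
Qed.

Lemma warmup_le : (@warmup R T <= T)%N.
Proof.
rewrite /warmup truncn_le_nat -natr1 ltr_pwDr ?ltr01 //.
rewrite -[leRHS]ger0_norm // -sqrtr_sqr ler_sqrt ?sqr_ge0 // -natrX ler_nat.
by case: T => // n; rewrite leq_pmulr.
Qed.

(** Warm-up rounds contribute no update. The upper end is written [warmup + (T - warmup)] to match
    the induction on main-phase rounds below. *)
Lemma num_updatesE : num_updates T lambda b x est =
  (\sum_((@warmup R T).+1 <= t < (@warmup R T + (T - @warmup R T)).+1)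
    is_update T lambda b x est t)%N.
Proof.
rewrite /num_updates subnKC ?warmup_le //.
rewrite (big_cat_nat (n := (@warmup R T).+1)) //=; last first.
  by rewrite ltnS warmup_le.
rewrite big_nat big1 ?add0n // => t /andP[_ t_le].
by rewrite /is_update ltnNge -ltnS t_le.
Qed.

(** Induction on [n]: an update doubles the left side and, by its own test, at least doubles the
    right; any other round changes neither. *)
Lemma det_last_update_ge n :
  2 ^+ (\sum_((@warmup R T).+1 <= t < (@warmup R T + n).+1)
    is_update T lambda b x est t) * lambda ^+ (N * d)
  <= \det (H (last_update T lambda b x est n)).
Proof.
elim: n => [|n IHn].
  by rewrite addn0 /= /H /Hmx !big_geq // mul1r addr0 det_scalar.
rewrite addnS big_nat_recr /=; last by rewrite ltnS leq_addr.
rewrite exprD mulrAC {2}/is_update.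
(* With the subtraction simplified, the test in [is_update] is literally the one branched on in
   [last_update]. *)
rewrite ltnS leq_addr -addnS addKn /=; rewrite -addnS in IHn.
case: ifP => [det2|_]; last by rewrite expr0 mulr1; exact: IHn.
by apply: le_trans det2; rewrite expr1 mulrC ler_pM2l //; exact: IHn.
Qed.

End DesignMatrix.

(** * Bounds on slates, weights and [lambda], and passage to logarithms *)

Lemma slate_coord_sqr_le1 (R : realType) (N d : nat) (X : 'I_N -> set 'rV[R]_d)
    (x : 'rV[R]_(N * d)) :
    (forall i z, X i z -> l2norm z <= (Num.sqrt N%:R)^-1) ->
  slates X x -> forall j, x 0 j ^+ 2 <= 1.
Proof.
move=> X_le Xx j; case/mxvec_indexP: j => i l.
have -> : x 0 (mxvec_index i l) = block x i 0 l.
  by rewrite /block !mxE.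
(* The slot [i : 'I_N] itself witnesses that [N] is positive. *)
have N_ge1 : 1 <= Num.sqrt (N%:R : R).
  rewrite -[leLHS]sqrtr1 ler_sqrt ?ler0n // ler1n.
  by rewrite (leq_ltn_trans _ (ltn_ord i)).
have z_le1 : l2norm (block x i) <= 1.
  by apply: le_trans (X_le _ _ (Xx i)) _; rewrite invf_le1 // (lt_le_trans ltr01).
have dotE : dot (block x i) (block x i) = \sum_j block x i 0 j ^+ 2.
  by rewrite /dot mxE; apply: eq_bigr => j _; rewrite [_^T _ _]mxE expr2.
move: z_le1; rewrite /l2norm -[leRHS]sqrtr1 ler_sqrt ?ler01 // dotE.
apply: le_trans; rewrite (bigD1 l) //= lerDl.
by apply: sumr_ge0 => *; exact: sqr_ge0.
Qed.

Lemma weight_bounds (R : realType) (N d T : nat) (Rmax Lmu : R) (b : R -> R)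
    (x est : nat -> 'rV[R]_(N * d)) k :
  glm_link Rmax Lmu b -> 0 <= weight T b x est k <= Lmu.
Proof.
move=> [_ db2 b_homo b_lip _]; rewrite /weight.
set z := dot _ _.
have dz_ge0 : 0 <= derive1n 2 b z := derive1_ge0_nondecreasing b_homo (db2 z).
have dz_le : derive1n 2 b z <= Lmu := derive1_le_lipschitz b_lip (db2 z).
rewrite divr_ge0 ?expR_ge0 //= ler_pdivrMr ?expR_gt0 //.
apply: (le_trans dz_le); rewrite ler_peMr //; first exact: le_trans dz_le.
by rewrite ltW // pexpR_gt1.
Qed.

(** Logarithms give [k * ln 2 <= m * (ln t + ln (1 + D))]. As [t >= 2], the constant [ln (1 + D)] is
    at most [ln (1 + D) / ln 2] times [ln t]. *)
Lemma exp2_bound_ln (R : realType) (k m : nat) (D t : R) :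
    0 <= D -> 2 <= t -> 2 ^+ k <= (t * (1 + D)) ^+ m ->
  k%:R <= (ln 2)^-1 * (1 + ln (1 + D) / ln 2) * (m%:R * ln t).
Proof.
move=> D_ge0 t_ge2 le_pow.
have t_gt0 : 0 < t by apply: lt_le_trans t_ge2.
have D1_gt0 : 0 < 1 + D by rewrite ltr_pwDl.
have ln2_gt0 : 0 < ln 2 :> R by rewrite ln_gt0 // ltr1n.
have ln_t : ln 2 <= ln t by rewrite ler_ln ?posrE.
have lnD_ge0 : 0 <= ln (1 + D) by rewrite ln_ge0 // lerDl.
have : ln (2 ^+ k) <= ln ((t * (1 + D)) ^+ m).
  by rewrite ler_ln ?posrE ?exprn_gt0 // mulr_gt0.
rewrite !lnXn ?mulr_gt0 // lnM ?posrE //.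
rewrite -[_ *+ k]mulr_natl -[_ *+ m]mulr_natl => le_ln.
rewrite -(ler_pM2r ln2_gt0); apply: le_trans le_ln _.
have -> : (ln 2)^-1 * (1 + ln (1 + D) / ln 2) * (m%:R * ln t) * ln 2
    = m%:R * (ln t + ln (1 + D) * (ln t / ln 2)) by field; rewrite gt_eqF.
by rewrite ler_wpM2l // lerD2l ler_peMr // ler_pdivlMr // mul1r.
Qed.

(** The factors [N], [d] and [Rmax ^+ 2] are at least 1 and [T / delta] is at least 2, so a bound
    depending on [cl] and [S] alone remains. *)
Lemma lambda_lower_bound (R : realType) (S cl Rmax delta : R) (N d T : nat) :
    0 < S -> 0 < cl -> (0 < N)%N -> (0 < d)%N -> (1 < T)%N -> 1 <= Rmax ->
    0 < delta <= 1 ->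
  cl * S^-1 * ln 2 <=
  cl * (N%:R * d%:R * Rmax ^+ 2 * S^-1 * ln (T%:R / delta)).
Proof.
move=> S_gt0 cl_gt0 N_gt0 d_gt0 T_gt1 R_ge1 /andP[delta_gt0 delta_le1].
rewrite -mulrA ler_pM2l //.
have Si_gt0 : 0 < S^-1 by rewrite invr_gt0.
rewrite mulrAC [leRHS]mulrC ler_pM2l //.
have Td_ge2 : 2 <= T%:R / delta.
  rewrite ler_pdivlMr //; apply: (@le_trans _ _ 2); last by rewrite ler_nat.
  by rewrite ger_pMr.
have le_ln : ln 2 <= ln (T%:R / delta).
  by rewrite ler_ln ?posrE // (lt_le_trans _ Td_ge2).
have ln_ge0 : 0 <= ln (T%:R / delta).
  by rewrite ln_ge0 // (le_trans _ Td_ge2) // ler1n.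
apply: le_trans le_ln _; rewrite ler_peMl // -natrM.
rewrite mulr_ege1 ?ler1n ?muln_gt0 ?N_gt0 //.
by rewrite exprn_ege1.
Qed.

Theorem lemma4p1 (R : realType) (S Lmu cl Cl Cg Cb : R)
    (hS : 1 < S) (hLmu : 1 < Lmu)
    (hcl : 0 < cl) (hCl : 0 < Cl) (hCg : 0 < Cg) (hCb : 0 < Cb) :
  exists C : R, 0 < C /\
  forall (N d T : nat) (Rmax kappa delta lambda gamma beta : R)
    (disp : measure_display) (Om : measurableType disp) (P : probability Om R)
    (nu : {sigma_finite_measure set R -> \bar R}) (b c : R -> R)
    (theta : 'rV[R]_(N * d)) (X : Om -> nat -> 'I_N -> set 'rV[R]_d)
    (x : Om -> nat -> 'rV[R]_(N * d)) (r : Om -> nat -> R)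
    (est : Om -> nat -> 'rV[R]_(N * d)),
  (1 < N)%N -> (1 < d)%N -> (1 < T)%N -> 1 < Rmax -> 1 < kappa ->
  0 < delta < 1 ->
  cl * (N%:R * d%:R * Rmax ^+ 2 * S^-1 * ln (T%:R / delta)) <= lambda
    <= Cl * (N%:R * d%:R * Rmax ^+ 2 * S^-1 * ln (T%:R / delta)) ->
  0 < gamma <= Cg * (Rmax ^+ 2 * (S `^ (3 / 2)) *
    Num.sqrt (N%:R * d%:R * ln (S * T%:R / delta))) ->
  0 < beta <= Cb * (Rmax *
    Num.sqrt (N%:R * d%:R * S * ln (S * T%:R / delta))) ->
  slate_glm T S Rmax Lmu kappa P nu b c theta X x r ->
  forall w : Om,
  rs_slate_glincb_run T S kappa lambda gamma beta b (X w) (x w) (r w) (est w) ->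
  (num_updates T lambda b (x w) (est w))%:R <= C * (N%:R * d%:R * ln T%:R).
Proof.
have Lmu_gt0 : 0 < Lmu by apply: lt_trans hLmu.
have ln2_gt0 : 0 < ln 2 :> R by rewrite ln_gt0 // ltr1n.
pose lambda0 := cl * S^-1 * ln 2.
have lambda0_gt0 : 0 < lambda0.
  by rewrite !mulr_gt0 // invr_gt0 (lt_trans ltr01).
pose D := Lmu / lambda0.
have D_ge0 : 0 <= D by rewrite divr_ge0 ?ltW.
(* The constant from [exp2_bound_ln]; through [D] it depends only on [S], [Lmu] and [cl], hence is
   fixed before [N], [d], [T] and the other parameters. *)
exists ((ln 2)^-1 * (1 + ln (1 + D) / ln 2)); split.
  rewrite mulr_gt0 ?invr_gt0 // ltr_pwDl // divr_ge0 ?(ltW ln2_gt0) //.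
  by rewrite ln_ge0 // lerDl.
move=> N d T Rmax kappa delta lambda gamma beta disp Om P nu b c theta X x r est.
move=> N_gt1 d_gt1 T_gt1 R_gt1 _ delta01 /andP[lambda_ge _] _ _ model w run.
have lambda_ge0 : lambda0 <= lambda.
  have /andP[delta_gt0 delta_lt1] := delta01.
  have S_gt0 : 0 < S by apply: lt_trans hS.
  apply: le_trans lambda_ge; apply: lambda_lower_bound => //.
  - exact: ltnW.
  - exact: ltnW.
  - exact: ltW.
  - by rewrite delta_gt0 ltW.
have lambda_gt0 : 0 < lambda by apply: lt_le_trans lambda_ge0.
rewrite -natrM; apply: exp2_bound_ln => //; first by rewrite ler_nat.
(* Multiplying by the initial determinant [lambda ^+ (N * d)] lets both sides be compared with the
   determinant at the last update. *)
rewrite -(ler_pM2r (exprn_gt0 (N * d) lambda_gt0)) num_updatesE.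
apply: le_trans; first exact: det_last_update_ge.
set s := last_update _ _ _ _ _ _.
have s_le : (s <= T)%N.
  by apply: leq_trans (last_update_le _ _ _ _ _ _) _; rewrite subnKC ?warmup_le.
apply: (@le_trans _ _ ((lambda + s%:R * Lmu) ^+ (N * d))).
  apply: det_Hmx_le => //; first exact: ltW.
    by move=> k _; exact: weight_bounds (model_link model).
  move=> k j /andP[k_gt k_lt].
  have k_le : (k <= T)%N by rewrite (leq_trans (ltnW k_lt)).
  apply: (slate_coord_sqr_le1 (X := X w k)) => [i z|i].
    by apply: (model_items model); rewrite k_le (leq_ltn_trans _ k_gt).
  (* Items kept after elimination still belong to the original item set. *)
  by have [[]] := run_main run i (introT andP (conj k_gt k_le)).
(* It remains to see [lambda + s * Lmu <= T * (1 + D) * lambda]: here [lambda <= T * lambda], and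
   [D * lambda >= Lmu] because [lambda >= lambda0]. *)
rewrite -exprMn; apply: lerXn2r; rewrite ?nnegrE.
- by rewrite addr_ge0 ?(ltW lambda_gt0) // mulr_ge0 // ltW.
- by rewrite !mulr_ge0 ?addr_ge0 // ltW.
rewrite mulrAC mulrDr mulr1 lerD //.
  by rewrite ler_peMl ?(ltW lambda_gt0) // ler1n ltnW.
rewrite -mulrA ler_pM ?ler_nat ?(ltW Lmu_gt0) //.
rewrite /D mulrCA ler_peMr ?(ltW Lmu_gt0) //.
by rewrite ler_pdivlMr // mul1r.
Qed.
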